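(* Let $\widehat{A}=A+\varepsilon B$ be an $n\times n$ dual matrix with $A,B\in\mathbb{R}^{n\times n}$ and $\mathrm{rank}(A)=r$. Let $$A=U\begin{bmatrix}\Sigma K & \Sigma L\\ 0 & 0\end{bmatrix}U^{T},\qquad B=U\begin{bmatrix}B_1 & B_2\\ B_3 & B_4\end{bmatrix}U^{T},$$ where $U\in\mathbb{R}^{n\times n}$ is orthogonal, $\Sigma=\mathrm{diag}(\sigma_1,\dots,\sigma_r)$ with $\sigma_1\ge\cdots\ge\sigma_r>0$ the nonzero singular values of $A$, $K\in\mathbb{R}^{r\times r}$ and $L\in\mathbb{R}^{r\times(n-r)}$ satisfy $KK^{T}+LL^{T}=I_r$, and $B_1\in\mathbb{R}^{r\times r}$ (the other blocks of conforming sizes). Then the dual index of $\widehat{A}$ is equal to one if and only if $\mathrm{Ind}(A)=1$ and $B_4=B_3K^{-1}L$.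
   Context: Dual numbers are $a+\varepsilon a'$ with $a,a'\in\mathbb{R}$ and $\varepsilon\neq 0$, $\varepsilon^2=0$ (i.e. the ring $\mathbb{R}[\varepsilon]/(\varepsilon^2)$). A dual matrix is a matrix over dual numbers, written $\widehat{A}=A+\varepsilon B$ with $A,B$ real. The range $\mathcal{R}(\widehat{A})$ of an $n\times n$ dual matrix is $\{\widehat{A}\widehat{x}: \widehat{x}$ a dual column vector of length $n\}$. The dual index of an $n\times n$ dual matrix $\widehat{A}$ is said to be equal to one if $\mathcal{R}(\widehat{A}^2)=\mathcal{R}(\widehat{A})$. For a real square matrix $A$, ''$\mathrm{Ind}(A)=1$'' means $\mathrm{rank}(A^2)=\mathrm{rank}(A)$. Every real square matrix $A$ of rank $r$ admits a decomposition of the stated form (Hartwig–Spindelböck), and $\mathrm{Ind}(A)=1$ holds exactly when $K$ is nonsingular, so that $K^{-1}$ makes sense in the stated condition. *)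

(* Defs.v *)
From HB Require Import structures.
From mathcomp Require Import all_boot all_order all_algebra.
From mathcomp Require Import classical_sets reals.

Set Implicit Arguments.
Unset Strict Implicit.
Unset Printing Implicit Defensive.

Import Order.TTheory GRing.Theory Num.Theory.
Local Open Scope ring_scope.
Local Open Scope classical_set_scope.

Definition dual (R : realType) : comNzRingType := {poly %/ ('X^2 : {poly R})}.

Definition dual_of (R : realType) (a : R) : dual R := qpolyC 'X^2 a.

Definition dual_eps (R : realType) : dual R := qpolyX 'X^2.

Definition dual_mx (R : realType) (m n : nat) (A B : 'M[R]_(m, n)) :
    'M[dual R]_(m, n) :=
  map_mx (@dual_of R) A + dual_eps R *: map_mx (@dual_of R) B.

Definition dual_range (R : realType) (n : nat) (A : 'M[dual R]_n) :
    set 'cV[dual R]_n :=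
  [set A *m x | x in [set: 'cV[dual R]_n]].

Definition dual_index_one (R : realType) (n : nat) (A : 'M[dual R]_n) : Prop :=
  dual_range (A *m A) = dual_range A.

(* Nonsingular matrices (classically of index 0) satisfy this condition too. *)
Definition index_one (R : realType) (n : nat) (A : 'M[R]_n) : bool :=
  \rank (A *m A) == \rank A.

Definition orthogonal_mx (R : realType) (n : nat) (U : 'M[R]_n) : Prop :=
  U *m U^T = 1%:M.

(* The squares of the singular values are the eigenvalues of A^T A; reading
   them off the characteristic polynomial keeps track of multiplicities, and
   the factor 'X^(n - r) says that the list sigma is complete. *)
Definition nonzero_singular_values (R : realType) (n r : nat)
    (A : 'M[R]_n) (sigma : 'rV[R]_r) : Prop :=
  (forall i, 0 < sigma 0 i) /\
  char_poly (A^T *m A) =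
    'X^(n - r) * \prod_(i < r) ('X - (sigma 0 i ^+ 2)%:P).

Lemma val_dual_eps (R : realType) : dual_eps R = 'X :> {poly R}.
Proof. by rewrite /dual_eps qpolyXE ?size_polyXn ?monicXn. Qed.

Lemma dual_eps_neq0 (R : realType) : dual_eps R != 0.
Proof.
apply/eqP => /(congr1 (@polyn R _)).
by rewrite val_dual_eps; apply/eqP; rewrite polyX_eq0.
Qed.

Lemma dual_eps_sqr (R : realType) : dual_eps R ^+ 2 = 0.
Proof.
apply: val_inj; change (val (in_qpoly 'X^2 ((dual_eps R : {poly R}) * dual_eps R)) = 0).
rewrite val_dual_eps /= mk_monic_Xn -expr2.
exact: Pdiv.RingMonic.rmodpp (monicXn _ _).
Qed.

Lemma val_dual_mk (R : realType) (a b : R) :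
  dual_of a + dual_eps R * dual_of b = a%:P + b *: 'X :> {poly R}.
Proof.
change ((dual_of a : {poly R}) +
  in_qpoly 'X^2 ((dual_eps R : {poly R}) * dual_of b) = a%:P + b *: 'X).
rewrite val_dual_eps /= mulrC mul_polyC Pdiv.CommonRing.rmodp_small //.
by rewrite mk_monic_Xn size_polyXn (leq_ltn_trans (size_scale_leq _ _)) ?size_polyX.
Qed.

Lemma dual_decomp (R : realType) (z : dual R) :
  exists! ab : R * R, z = dual_of ab.1 + dual_eps R * dual_of ab.2.
Proof.
have sz : (size (z : {poly R}) <= 2)%N.
  by rewrite (leq_trans (size_npoly z)) ?mk_monic_Xn ?size_polyXn.
exists ((z : {poly R})`_0, (z : {poly R})`_1); split => [|[a b] /= zE].
  apply: val_inj; rewrite [RHS]val_dual_mk; apply/polyP => -[|[|i]];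
    rewrite coefD coefC coefZ coefX /= ?(mulr0, mulr1, addr0, add0r) //.
  by rewrite nth_default // (leq_trans sz).
rewrite zE !val_dual_mk !(coefD, coefC, coefZ, coefX) /=.
by rewrite !(mulr0, mulr1, addr0, add0r).
Qed.

(* Main.v *)
(** Over any commutative ring, R(A^2) = R(A) means A = A^2 X for some X, a
    condition invariant under similarity.  For A + eps B it splits into
    A = A^2 X and B = A^2 Y + (AB + BA) X.  When A = [P Q; 0 0] with [P Q]
    right invertible, the first equation says that P is invertible and
    [P Q] X = [I, P^-1 Q]; the top rows of the second can always be solved for
    Y, and its bottom rows read [B3 B4] = B3 [I, P^-1 Q].  Finally P = Sigma K
    and Q = Sigma L give P^-1 Q = K^-1 L. *)

Require Import Defs.
From mathcomp Require Import all_boot all_order all_algebra.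
From mathcomp Require Import classical_sets reals.

Set Implicit Arguments.
Unset Strict Implicit.
Unset Printing Implicit Defensive.

Import Order.TTheory GRing.Theory Num.Theory.
Local Open Scope ring_scope.

(** Stated over an arbitrary commutative ring so that it applies to real and to dual matrices
    alike. *)
Definition factors_through_square (D : comNzRingType) (n : nat) (A : 'M[D]_n) :=
  exists X, A = A *m A *m X.

Lemma factors_through_square_conj (D : comNzRingType) (n : nat)
    (A U V : 'M[D]_n) :
  U *m V = 1%:M ->
  factors_through_square (U *m A *m V) <-> factors_through_square A.
Proof.
have conjW (M P Q : 'M[D]_n) : Q *m P = 1%:M ->
    factors_through_square M -> factors_through_square (P *m M *m Q).
  move=> QP [X MX]; exists (P *m X *m Q); rewrite {1}MX !mulmxA.
  by rewrite -!(mulmxA _ Q P) QP !mulmx1.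
(* One-sided inverses of square matrices are two-sided, so conjugating back by [V] and [U] gives the
   converse. *)
move=> UV; have VU := mulmx1C UV; split; last exact: conjW.
by move/(conjW _ V U UV); rewrite !mulmxA VU mul1mx -mulmxA VU mulmx1.
Qed.

(** The column space of [A *m A] lies in that of [A], so equal ranks force equality. Since [<=]
    compares row spaces, the argument is run on transposes. *)
Lemma index_oneP (R : realType) (n : nat) (A : 'M[R]_n) :
  index_one A <-> factors_through_square A.
Proof.
have rkE : index_one A = (A^T <= (A *m A)^T)%MS.
  rewrite /index_one -mxrank_tr -[X in _ == X]mxrank_tr.
  by rewrite mxrank_leqif_sup // trmx_mul submxMl.
rewrite rkE; split=> [/submxP[X AX]|[X AX]].
  by exists X^T; apply: trmx_inj; rewrite trmx_mul trmxK.
by rewrite {1}AX trmx_mul submxMl.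
Qed.

Section DualMatrices.

Variables (R : realType) (n : nat).
Implicit Types A B C D : 'M[R]_n.

(** Each column of [A] lies in the range of [A], hence has a preimage under [A *m A]; these
    preimages are the columns of [X]. *)
Lemma dual_index_oneP (A : 'M[dual R]_n) :
  dual_index_one A <-> factors_through_square A.
Proof.
split=> [rangeA|[X AX]].
  have colA j : exists x : 'cV_n, A *m A *m x = col j A.
    have : dual_range A (col j A) by exists (delta_mx j 0); rewrite // -colE.
    by rewrite -rangeA => -[x _ xE]; exists x.
  have [x xE] := fin_all_exists colA.
  exists (\matrix_(i, j) x j i 0); apply/matrixP => i j.
  have -> : A i j = (A *m A *m x j) i 0 by rewrite xE mxE.
  by rewrite !mxE; apply: eq_bigr => k _; rewrite [in RHS]mxE.
apply/seteqP; split=> _ [x _ <-]; last by exists (X *m x); rewrite // mulmxA -AX.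
by exists (A *m x); rewrite // mulmxA.
Qed.

Lemma dual_mxE A B i j :
  dual_mx A B i j = dual_of (A i j) + dual_eps R * dual_of (B i j).
Proof. by rewrite !mxE. Qed.

Lemma dual_mxM A B C D :
  dual_mx A B *m dual_mx C D = dual_mx (A *m C) (A *m D + B *m C).
Proof.
rewrite /dual_mx /dual_of map_mxD !map_mxM mulmxDl !mulmxDr -!scalemxAr -!scalemxAl.
by rewrite scalerA -expr2 dual_eps_sqr scale0r addr0 scalerDr addrA.
Qed.

Lemma dual_mx_inj A B C D : dual_mx A B = dual_mx C D -> A = C /\ B = D.
Proof.
move=> AC; suff coord i j : (A i j, B i j) = (C i j, D i j).
  by split; apply/matrixP => i j; case: (coord i j).
have [z [zE zU]] := dual_decomp (dual_mx A B i j).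
transitivity z; last by apply: zU; rewrite AC dual_mxE.
by apply/esym/zU; rewrite dual_mxE.
Qed.

Lemma dual_mx_surj (X : 'M[dual R]_n) : exists C D, X = dual_mx C D.
Proof.
have entry (ij : 'I_n * 'I_n) : exists ab : R * R,
    X ij.1 ij.2 = dual_of ab.1 + dual_eps R * dual_of ab.2.
  by have [ab [abE _]] := dual_decomp (X ij.1 ij.2); exists ab.
have [f fE] := fin_all_exists entry.
exists (\matrix_(i, j) (f (i, j)).1), (\matrix_(i, j) (f (i, j)).2).
by apply/matrixP => i j; rewrite dual_mxE !mxE -(fE (i, j)).
Qed.

Lemma dual_mx_factors_through_squareP A B :
  factors_through_square (dual_mx A B) <->
  exists X Y, A = A *m A *m X /\ B = A *m A *m Y + (A *m B + B *m A) *m X.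
Proof.
split=> [[Z]|[X [Y [AX BY]]]].
  have [X [Y ->]] := dual_mx_surj Z.
  by rewrite !dual_mxM => /dual_mx_inj[AX BY]; exists X, Y.
by exists (dual_mx X Y); rewrite !dual_mxM -AX -BY.
Qed.

(** Turns the simultaneous conjugation of [A] and [B] by the real [U] into a single similarity over
    the dual numbers. *)
Lemma dual_mx_real_conj A B C D :
  dual_mx (A *m C *m B) (A *m D *m B) = dual_mx A 0 *m dual_mx C D *m dual_mx B 0.
Proof. by rewrite !dual_mxM !(mulmx0, mul0mx, addr0, add0r). Qed.

Lemma dual_mx1 : dual_mx 1%:M 0 = 1%:M :> 'M[dual R]_n.
Proof. by rewrite /dual_mx /dual_of map_mx1 map_mx0 scaler0 addr0. Qed.

End DualMatrices.

Section BlockForm.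

Variables (R : realType) (r s : nat).
Variables (P : 'M[R]_r) (Q : 'M[R]_(r, s)) (W : 'M[R]_(r + s, r)).
Hypothesis PQW : row_mx P Q *m W = 1%:M.

Let M : 'M[R]_(r + s) := block_mx P Q 0 0.

Let ME : M = col_mx (row_mx P Q) 0.
Proof. by rewrite /M block_mxEv row_mx0. Qed.

Lemma sqr_block_row0 : M *m M = col_mx (P *m row_mx P Q) 0.
Proof. by rewrite {1}ME mul_col_mx mul0mx ME mul_row_col mulmx0 addr0. Qed.

Lemma block_row0_factors_through_squareP X :
  M = M *m M *m X <-> P \in unitmx /\ row_mx P Q *m X = row_mx 1%:M (invmx P *m Q).
Proof.
rewrite sqr_block_row0 mul_col_mx mul0mx ME -mulmxA.
split=> [/eq_col_mx[PQX _]|[uP ->]]; last by rewrite mul_mx_row mulmx1 mulKVmx.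
have uP : P \in unitmx.
  (* Multiplying [row_mx P Q = P *m (row_mx P Q *m X)] on the right by [W] exhibits a right inverse
     of [P]. *)
  have /mulmx1_unit[] // : P *m (row_mx P Q *m X *m W) = 1%:M.
  by rewrite mulmxA -PQX.
by split=> //; rewrite -[LHS](mulKmx uP) -PQX mul_mx_row mulVmx.
Qed.

Lemma block_row0_factors_through_square :
  factors_through_square M <-> P \in unitmx.
Proof.
split=> [[X /block_row0_factors_through_squareP[]] //|uP].
exists (W *m row_mx 1%:M (invmx P *m Q)).
by apply/block_row0_factors_through_squareP; rewrite mulmxA PQW mul1mx.
Qed.

Lemma dual_block_row0_factors_through_square B1 B2 B3 B4 :
  factors_through_square (dual_mx M (block_mx B1 B2 B3 B4)) <->
  P \in unitmx /\ B4 = B3 *m (invmx P *m Q).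
Proof.
set N := block_mx _ _ _ _.
(* The bottom rows of [M *m N] vanish and those of [N *m M] are [B3 *m row_mx P Q], so the bottom
   rows of the product depend on [B3] alone. *)
have crossE X : row_mx P Q *m X = row_mx 1%:M (invmx P *m Q) ->
    (M *m N + N *m M) *m X =
    col_mx (row_mx P Q *m N *m X + B1 *m row_mx 1%:M (invmx P *m Q))
           (row_mx B3 (B3 *m (invmx P *m Q))).
  move=> PQX.
  have MN : M *m N = col_mx (row_mx P Q *m N) 0 by rewrite ME mul_col_mx mul0mx.
  have NM : N *m M = col_mx (B1 *m row_mx P Q) (B3 *m row_mx P Q).
    by rewrite ME /N mul_block_col !mulmx0 !addr0.
  rewrite MN NM add_col_mx add0r mul_col_mx mulmxDl -!mulmxA PQX.
  by rewrite [B3 *m _]mul_mx_row mulmx1.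
split=> [/dual_mx_factors_through_squareP[X [Y []]]|[uP B4E]].
  move=> /block_row0_factors_through_squareP[uP PQX].
  rewrite crossE // sqr_block_row0 mul_col_mx mul0mx add_col_mx add0r /N block_mxEv.
  by move=> /eq_col_mx[_ /eq_row_mx[_ ->]].
have [X PQX] : exists X, row_mx P Q *m X = row_mx 1%:M (invmx P *m Q).
  by exists (W *m row_mx 1%:M (invmx P *m Q)); rewrite mulmxA PQW mul1mx.
(* [W *m invmx P] is a right inverse of [P *m row_mx P Q], so [M *m M *m Y] can be given any top
   block. *)
have PPQK T : P *m row_mx P Q *m (W *m invmx P *m T) = T.
  by rewrite !mulmxA -(mulmxA P) PQW mulmx1 mulmxV // mul1mx.
(* [T] is the top block from [crossE]; [Y] has to supply the rest of [row_mx B1 B2]. *)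
pose T := row_mx P Q *m N *m X + B1 *m row_mx 1%:M (invmx P *m Q).
apply/dual_mx_factors_through_squareP.
exists X, (W *m invmx P *m (row_mx B1 B2 - T)); split.
  exact/block_row0_factors_through_squareP.
rewrite crossE // sqr_block_row0 mul_col_mx mul0mx add_col_mx add0r PPQK subrK.
by rewrite -B4E /N block_mxEv.
Qed.

End BlockForm.

Theorem theorem2p2 (R : realType) (r s : nat)
    (A B U : 'M[R]_(r + s)) (sigma : 'rV[R]_r)
    (K : 'M[R]_r) (L : 'M[R]_(r, s))
    (B1 : 'M[R]_r) (B2 : 'M[R]_(r, s)) (B3 : 'M[R]_(s, r)) (B4 : 'M[R]_s)
    (rankA : \rank A = r)
    (orthU : orthogonal_mx U)
    (sigma_sv : nonzero_singular_values A sigma)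
    (sigma_sorted : forall i j : 'I_r, (i <= j)%N -> sigma 0 j <= sigma 0 i)
    (KL : K *m K^T + L *m L^T = 1%:M)
    (AE : A = U *m block_mx (diag_mx sigma *m K) (diag_mx sigma *m L) 0 0 *m U^T)
    (BE : B = U *m block_mx B1 B2 B3 B4 *m U^T) :
  dual_index_one (dual_mx A B) <->
  index_one A /\ B4 = B3 *m invmx K *m L.
Proof.
have [sigma_gt0 _] := sigma_sv; pose S := diag_mx sigma.
have uS : S \in unitmx.
  rewrite unitmxE det_diag unitfE; apply/prodf_neq0 => i _.
  by rewrite gt_eqF ?sigma_gt0.
(* The product is [S *m (K *m K^T + L *m L^T) *m invmx S], which is where [KL] enters. *)
have PQW : row_mx (S *m K) (S *m L) *m (col_mx K^T L^T *m invmx S) = 1%:M.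
  by rewrite mulmxA mul_row_col -!(mulmxA S) -mulmxDr KL mulmx1 mulmxV.
have dualU : dual_mx U 0 *m dual_mx U^T 0 = 1%:M.
  by rewrite dual_mxM orthU mulmx0 mul0mx addr0 dual_mx1.
rewrite dual_index_oneP index_oneP BE AE dual_mx_real_conj.
rewrite !factors_through_square_conj //.
rewrite (dual_block_row0_factors_through_square PQW).
rewrite (block_row0_factors_through_square PQW).
have uSK : (S *m K \in unitmx) = (K \in unitmx) by rewrite unitmx_mul uS.
suff PQ : K \in unitmx -> invmx (S *m K) *m (S *m L) = invmx K *m L.
  by rewrite uSK; split=> -[uK]; rewrite ?PQ // ?mulmxA // -mulmxA; split; rewrite ?PQ.
(* Left multiplication by the invertible [S *m K] turns both sides into [S *m L]. *)
move=> uK; apply: (can_inj (mulKmx (_ : S *m K \in unitmx))); first by rewrite uSK.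
by rewrite mulKVmx ?uSK // -mulmxA mulKVmx.
Qed.
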